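(* Let $T$ be the lifetime of a coherent system with identically distributed components (with the distribution of $X$), let its distortion function be $q$, and let $\phi_\alpha(u)=u[-Ln_\alpha u]^{1/\alpha}$. Then for all $0<\alpha<1$, $$\omega_{1,\alpha}\,\mathcal{E}^*_\alpha(X)\leq\mathcal{E}^*_\alpha(T)\leq\omega_{2,\alpha}\,\mathcal{E}^*_\alpha(X),$$ where $\omega_{1,\alpha}=\inf_{u\in(0,1)}\frac{\phi_\alpha(q(u))}{\phi_\alpha(u)}$ and $\omega_{2,\alpha}=\sup_{u\in(0,1)}\frac{\phi_\alpha(q(u))}{\phi_\alpha(u)}$.
   Context: For $0<\alpha<1$, $E_\alpha(x)=\sum_{k\ge 0} x^k/\Gamma(\alpha k+1)$ is the Mittag-Leffler function and $Ln_\alpha$ denotes its inverse; $Ln_\alpha 1=0$, $Ln_\alpha 0=-\infty$, $Ln_\alpha x<0$ for $x<1$, and the convention $0\cdot[-Ln_\alpha 0]^{1/\alpha}=0$ is used. For a non-negative absolutely continuous random variable $Z$ with CDF $F_Z$, the EFCPE is $\mathcal{E}^*_\alpha(Z)=\int_0^\infty F_Z(x)[-Ln_\alpha F_Z(x)]^{1/\alpha}\,dx$. A system is coherent if all its components are relevant and the system is monotone. For a coherent system with $n$ identically distributed components whose lifetimes have common CDF $F_X$, the system lifetime $T$ has CDF $F_T(t)=q(F_X(t))$, where the distortion function $q:[0,1]\to[0,1]$ is continuous and increasing with $q(0)=0$, $q(1)=1$ (it depends only on the system structure and the copula of the component lifetimes). All random variables are assumed non-negative and absolutely continuous. *)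

(* Defs.v *)
From HB Require Import structures.
From mathcomp Require Import all_boot all_order all_algebra.
From mathcomp Require Import all_classical all_reals all_analysis.

Set Implicit Arguments.
Unset Strict Implicit.
Unset Printing Implicit Defensive.

Import Order.TTheory GRing.Theory Num.Theory.
Import numFieldNormedType.Exports.

Local Open Scope classical_set_scope.
Local Open Scope ring_scope.

Section mittag_leffler.
Context {R : realType}.
Implicit Types a s t u x : R.

Definition Gamma s : R :=
  (\int[lebesgue_measure]_(t in `]0%R, +oo[) (t `^ (s - 1) * expR (- t)))%R.

Definition ML a x : R :=
  limn (series (fun k : nat => x ^+ k / Gamma (a * k%:R + 1))).

(* For 0 < a < 1, ML a is a bijection from R onto ]0, +oo[. Off that range
   (in particular at 0, where Ln_a 0 = -oo) the value of ML_ln is junk. *)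
Definition ML_ln a : R -> R := 'pinv_(fun=> 0) [set: R] (ML a).

(* Since 0 * y = 0 in R, phi a 0 = 0 whatever ML_ln a 0 is; this is the
   convention 0 [- Ln_a 0]^(1/a) = 0. *)
Definition phi a u : R := u * (- ML_ln a u) `^ a^-1.

End mittag_leffler.

Section random_lifetimes.
Context {d : measure_display} {T : measurableType d} {R : realType}.
Context (P : probability T R).

Definition cdfr (Z : {RV P >-> R}) (x : R) : R := fine (cdf Z x).

Definition EFCPE (a : R) (Z : {RV P >-> R}) : \bar R :=
  (\int[lebesgue_measure]_(x in `[0%R, +oo[) (phi a (cdfr Z x))%:E)%E.

Definition nonneg_ac (Z : {RV P >-> R}) : Prop :=
  {ae P, forall w, 0 <= Z w} /\
  distribution P Z `<< @lebesgue_measure R.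

End random_lifetimes.

Section coherent_systems.
Context {n : nat}.

(* A structure function S maps the set of working components to whether the
   system works. *)
Definition monotone_system (S : pred {set 'I_n}) : Prop :=
  forall A B : {set 'I_n}, A \subset B -> S A -> S B.

Definition relevant (S : pred {set 'I_n}) (i : 'I_n) : Prop :=
  exists A : {set 'I_n}, S (i |: A)%SET != S (A :\ i)%SET.

Definition coherent (S : pred {set 'I_n}) : Prop :=
  monotone_system S /\ forall i, relevant S i.

(* The system is alive at time t iff S holds of the set of components alive
   at time t; when 0 < n and S is coherent this determines TS. *)
Definition system_lifetime {T : Type} {R : realType} (S : pred {set 'I_n})
    (X : 'I_n -> T -> R) (TS : T -> R) : Prop :=
  forall w t, (t < TS w) = S [set i | t < X i w]%SET.

End coherent_systems.

(* When F is a continuous cdf, it takes every value in ]0, 1[, so these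
   conditions determine q on [0, 1]: it is the distortion function obtained
   from the system structure and the copula of the component lifetimes.
   "Increasing" is read in the weak sense. *)
Definition distortion_function {R : realType} (F FT q : R -> R) : Prop :=
  [/\ {in `[0, 1], forall u, q u \in `[0, 1]},
      {within `[0, 1], continuous q},
      {in `[0, 1] &, {homo q : u v / u <= v}},
      q 0 = 0 /\ q 1 = 1 &
      forall t, FT t = q (F t)].

Section bounds.
Context {R : realType}.
Implicit Types (a : R) (q : R -> R).

Definition omega1 a q : \bar R :=
  ereal_inf [set (phi a (q u) / phi a u)%:E | u in `]0, 1[].

Definition omega2 a q : \bar R :=
  ereal_sup [set (phi a (q u) / phi a u)%:E | u in `]0, 1[].

End bounds.

(* Main.v *)
Require Import Defs.
From HB Require Import structures.
From mathcomp Require Import all_boot all_order all_algebra.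
From mathcomp Require Import all_classical all_reals all_analysis.
From mathcomp Require Import measurable_realfun ring lra.
Import Order.TTheory GRing.Theory Num.Theory.
Import numFieldNormedType.Exports.
Local Open Scope classical_set_scope.
Local Open Scope ring_scope.

(** The cdfs satisfy [F_T = q o F_X], so the theorem is the integral of the
    pointwise inequality
    [omega1 * phi (F_X x) <= phi (q (F_X x)) <= omega2 * phi (F_X x)].
    Where [F_X x] is [0] or [1] everything vanishes, because [q] fixes [0] and
    [1] and [phi 0 = phi 1 = 0]. Where [u = F_X x] lies strictly between, the
    inequality is the definition of the infimum and the supremum, provided that
    one may divide by [phi u], that is, provided that [phi u > 0]. If the
    supremum is infinite, one needs the EFCPE of [X] to be positive unless
    [F_X] takes only the values [0] and [1] on the half line ([EFCPE_gt0]).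

    So the substance is in [phi_gt0] and [phi1], that is, in two facts on the
    Mittag-Leffler function [E] on the negative half line: [E x < 1] for
    [x < 0], and [E] takes there every value strictly between [0] and [1]. The
    power series alternates for [x < 0] and shows neither. Both follow from the
    continuity of [E] and from the bound of [ML_neg_le],
    [E (- l) <= 1 / (1 + l / Gamma (a + 1))] for [l >= 0].

    To prove this bound, replace [1 / Gamma (a k + 1)] in the series by
    [negbin (a k + 1) n / n ^ (a k)], where [negbin s n] is the coefficient of
    [z ^ n] in [(1 - z) ^ (- s)]. The series becomes the coefficient of [z ^ n]
    in [(1 - z) ^ (a - 1) / ((1 - z) ^ a + mu)] with [mu = l / n ^ a], and for
    these coefficients the analogous bound is purely algebraic
    ([resolvent_bound]): it rests on the fact that all the coefficients of
    [(1 - z) ^ a], except the constant one, are nonpositive. As [n] grows,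
    Gauss's limit for the Gamma function gives the convergence of each term
    ([negbin_Gamma_ge], [negbin_Gamma_le]), and a dominated convergence theorem
    for series ([tannery]) that of the sum. *)

(** * Coefficients of negative powers of [1 - z] *)

Section negbin.
Context {R : realType}.
Implicit Types (s t a mu : R) (n m i j k : nat).

(** The coefficient of [z ^ n] in the expansion of [(1 - z) ^ (- s)]. *)
Definition negbin s n : R := \prod_(i < n) ((s + i%:R) / i.+1%:R).

Lemma negbin0 s : negbin s 0 = 1.
Proof. by rewrite /negbin big_ord0. Qed.

Lemma negbinS s n : n.+1%:R * negbin s n.+1 = (s + n%:R) * negbin s n.
Proof.
rewrite /negbin big_ord_recr/=; set P := \prod_(_ < _) _.
have n0 : n.+1%:R != 0 :> R by rewrite pnatr_eq0.
by rewrite mulrCA [n.+1%:R * _]mulrC divfK// mulrC.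
Qed.

Lemma negbin_ge0 s n : 0 <= s -> 0 <= negbin s n.
Proof. by move=> s0; apply: prodr_ge0 => i _; rewrite divr_ge0 ?addr_ge0. Qed.

Lemma negbin1 n : negbin 1 n = 1.
Proof.
by rewrite /negbin big1// => i _; rewrite nat1r divff ?pnatr_eq0.
Qed.

(** For [0 < a < 1] only the first factor [(- a) / 1] is negative; so all the
    coefficients of [(1 - z) ^ a] but the constant one are nonpositive. *)
Lemma negbinN_le0 a n : 0 < a < 1 -> negbin (- a) n.+1 <= 0.
Proof.
move=> /andP[a0 a1]; rewrite /negbin big_ord_recl/= mulr_le0_ge0//.
  by rewrite addr0 invr1 mulr1 oppr_le0 ltW.
apply: prodr_ge0 => i _; rewrite divr_ge0// /bump/= natrD.
by have : 0 <= i%:R :> R by []; lra.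
Qed.

(** This is [(1 - z) ^ (- s) (1 - z) ^ (- t) = (1 - z) ^ (- (s + t))]. Both
    sides satisfy the recurrence of [negbinS]: the weight [n + 1] of the
    convolution splits as [i + (n + 1 - i)]. *)
Lemma vandermonde s t n :
  \sum_(i < n.+1) negbin s i * negbin t (n - i) = negbin (s + t) n.
Proof.
elim: n => [|n IH]; first by rewrite big_ord1 !negbin0 mulr1.
apply: (@mulfI _ n.+1%:R); first by rewrite pnatr_eq0.
rewrite negbinS -IH !mulr_sumr.
transitivity (\sum_(i < n.+2) (i%:R * negbin s i) * negbin t (n.+1 - i)
    + \sum_(i < n.+2) negbin s i * ((n.+1 - i)%N%:R * negbin t (n.+1 - i))).
  rewrite -big_split/=; apply: eq_bigr => i _.
  by rewrite natrB -1?ltnS//; ring.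
rewrite big_ord_recl/= !mul0r add0r [X in _ + X]big_ord_recr/= subnn.
rewrite !mul0r mulr0 addr0.
rewrite -big_split/=; apply: eq_bigr => i _.
rewrite /bump/= add1n negbinS subSS subSn -1?ltnS// negbinS natrB -1?ltnS//.
by ring.
Qed.

Lemma negbinD1 s n : negbin (s + 1) n = \sum_(i < n.+1) negbin s i.
Proof. by rewrite -vandermonde; apply: eq_bigr => i _; rewrite negbin1 mulr1. Qed.

(* The partial sums in k of the coefficient of z ^ j in
   (1 - z) ^ a / ((1 - z) ^ a + mu), expanded as a geometric series in
   mu (1 - z) ^ (- a). *)
Let dK a mu j K := \sum_(k < K) (- mu) ^+ k * negbin (a * k%:R) j.

(* Multiplication by (1 - z) ^ a shifts k by one. *)
Let dK_neg a mu m K :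
  \sum_(j < m.+1) negbin (- a) (m - j) * dK a mu j K.+1
  = negbin (- a) m - mu * dK a mu m K.
Proof.
rewrite /dK; under eq_bigr do rewrite mulr_sumr.
rewrite exchange_big/= big_ord_recl/=; congr (_ + _).
  rewrite mulr0n mulr0; transitivity (negbin (0 + - a) m); last by rewrite add0r.
  by rewrite -vandermonde; apply: eq_bigr => i _; rewrite expr0 mul1r mulrC.
rewrite mulr_sumr -sumrN; apply: eq_bigr => k _; rewrite /bump/= add1n.
have -> : a * k%:R = a * k.+1%:R + - a by rewrite -natr1; ring.
rewrite -vandermonde !mulr_sumr -sumrN; apply: eq_bigr => i _.
by rewrite exprS; ring.
Qed.

(* Multiplication by mu (1 - z) ^ (- a) shifts k the other way; the sums over
   i are the coefficients after division by 1 - z. *)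
Let dK_pos a mu m K :
  mu * \sum_(j < m.+1) negbin a (m - j) * \sum_(i < j.+1) dK a mu i K
  = 1 - \sum_(i < m.+1) dK a mu i K.+1.
Proof.
have uK j L : \sum_(i < j.+1) dK a mu i L =
    \sum_(k < L) (- mu) ^+ k * negbin (a * k%:R + 1) j.
  rewrite /dK exchange_big/=; apply: eq_bigr => k _.
  by rewrite negbinD1 mulr_sumr.
under eq_bigr do rewrite uK mulr_sumr.
rewrite uK [X in _ - X]big_ord_recl/= mulr0n mulr0 add0r negbin1 expr0 mulr1.
rewrite opprD addrA subrr add0r exchange_big/= mulr_sumr -sumrN.
apply: eq_bigr => k _; rewrite /bump/= add1n.
have -> : a * k.+1%:R + 1 = (a * k%:R + 1) + a by rewrite -natr1; ring.
rewrite -vandermonde !mulr_sumr -sumrN; apply: eq_bigr => i _.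
by rewrite exprS; ring.
Qed.

Let cvg_sumr (I : finType) (F : I -> nat -> R) (l : I -> R) :
  (forall i : I, F i @ \oo --> l i) ->
  (fun K => \sum_(i : I) F i K) @ \oo --> \sum_(i : I) l i.
Proof. by move=> h; apply: cvg_big => // -[x y]; exact: add_continuous. Qed.

(** Let [D(z) = (1 - z) ^ a / ((1 - z) ^ a + mu)], with coefficients [d], and
    let [u n = d 0 + ... + d n] be the coefficients of [D(z) / (1 - z)]. From
    [((1 - z) ^ a + mu) D = (1 - z) ^ a] and the signs of the coefficients of
    [(1 - z) ^ a] one gets, by strong induction, [d n <= 0] for [n > 0]; thus
    [u] is nonincreasing. Then the identity
    [u n + mu * sum_j negbin a (n - j) * u j = 1] bounds [u n], since each
    [u j] is at least [u n]. This is a discrete form of the maximum principle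
    for the fractional relaxation equation, of which Mittag-Leffler functions
    are the solutions. *)
Lemma resolvent_bound a mu n (d : nat -> R) : 0 < a < 1 -> 0 <= mu ->
  (forall j, (j <= n)%N ->
    (fun K => \sum_(k < K) (- mu) ^+ k * negbin (a * k%:R) j) @ \oo --> d j) ->
  (\sum_(j < n.+1) d j) * (1 + mu * negbin (a + 1) n) <= 1.
Proof.
move=> a01 mu0 dE.
(* the coefficients of ((1 - z) ^ a + mu) D = (1 - z) ^ a *)
have dneg m : (m <= n)%N ->
    \sum_(j < m.+1) negbin (- a) (m - j) * d j = negbin (- a) m - mu * d m.
  move=> mn.
  have lhs : (fun K => negbin (- a) m - mu * dK a mu m K) @ \oo -->
      \sum_(j < m.+1) negbin (- a) (m - j) * d j.
    under eq_fun do rewrite -dK_neg.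
    apply: cvg_sumr => i; apply: cvgM; first exact: cvg_cst.
    rewrite (cvg_shiftS (dK a mu i)).
    by apply: dE; rewrite (leq_trans _ mn)// -ltnS.
  apply: (cvg_unique _ lhs) => //.
  by apply: cvgB; [exact: cvg_cst|apply: cvgM; [exact: cvg_cst|exact: dE]].
(* the coefficients of (1 + mu (1 - z) ^ (- a)) D / (1 - z) = 1 / (1 - z) *)
have dpos : mu * \sum_(j < n.+1) negbin a (n - j) * \sum_(i < j.+1) d i
    = 1 - \sum_(i < n.+1) d i.
  have lhs : (fun K => 1 - \sum_(i < n.+1) dK a mu i K.+1) @ \oo -->
      mu * \sum_(j < n.+1) negbin a (n - j) * \sum_(i < j.+1) d i.
    under eq_fun do rewrite -dK_pos.
    apply: cvgM; first exact: cvg_cst.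
    apply: cvg_sumr => j; apply: cvgM; first exact: cvg_cst.
    apply: cvg_sumr => i; apply: dE.
    by rewrite -ltnS (leq_trans (ltn_ord i)).
  apply: (cvg_unique _ lhs) => //.
  apply: cvgB; first exact: cvg_cst.
  apply: cvg_sumr => i; rewrite (cvg_shiftS (dK a mu i)).
  by apply: dE; rewrite -ltnS.
have d0 : (1 + mu) * d 0 = 1.
  by have := dneg 0%N (leq0n _); rewrite big_ord1 subnn negbin0; lra.
have d01 : d 0 <= 1 by nra.
have d_le0 m : (m < n)%N -> d m.+1 <= 0.
  elim/ltn_ind: m => m IH mn.
  have := dneg _ mn.
  rewrite big_ord_recr big_ord_recl/= subnn subn0 negbin0 mul1r.
  set S := \sum_(i < m) _.
  have S0 : 0 <= S.
    apply: sumr_ge0 => i _; rewrite /bump/= add1n subSS.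
    have im : (i < m)%N by [].
    rewrite -(subnSK im) mulr_le0// ?negbinN_le0//.
    by apply: IH => //; exact: ltn_trans mn.
  have := negbinN_le0 a m a01.
  nra.
have u_mono j : (j <= n)%N -> \sum_(i < n.+1) d i <= \sum_(i < j.+1) d i.
  move=> jn; rewrite -!(big_mkord xpredT d) (@big_cat_nat _ _ _ j.+1)//=.
  rewrite gerDl big_nat_cond sumr_le0// => -[|i]/=; rewrite ?ltn0// ltnS.
  by rewrite andbT ltnS => /andP[_]; exact: d_le0.
set u := \sum_(j < n.+1) d j in dpos u_mono *.
suff : u * negbin (a + 1) n <=
    \sum_(j < n.+1) negbin a (n - j) * \sum_(i < j.+1) d i.
  by nra.
rewrite negbinD1 mulr_sumr.
have -> : \sum_(i < n.+1) u * negbin a i = \sum_(i < n.+1) negbin a (n - i) * u.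
  rewrite -(big_mkord xpredT (fun i => u * negbin a i)) big_nat_rev/= add0n.
  by rewrite big_mkord; apply: eq_bigr => i _; rewrite subSS mulrC.
apply: ler_sum => j _; rewrite ler_wpM2l ?u_mono -1?ltnS// negbin_ge0//.
by case/andP: a01 => /ltW.
Qed.

End negbin.

(** * Dominated integrals on the half line *)

Section gamma.
Context {R : realType}.
Implicit Types (s t c M : R).
Notation mu := (@lebesgue_measure R).

Lemma cvg_expR_half M : (M * expR (- (t / 2))) @[t --> +oo] --> (0 : R).
Proof.
rewrite -[X in _ --> X](mulr0 M); apply: cvgM; first exact: cvg_cst.
apply: (@cvg_comp _ _ _ (fun t : R => t / 2) (fun t => expR (- t)) _
  (pinfty_nbhs R)).
  exact: gt0_cvgMly.
exact: cvgr_expR.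
Qed.

Let is_derive_expR_half M t :
  is_derive t 1 (fun t => M * expR (- (t / 2))) (- (M / 2) * expR (- (t / 2))).
Proof. by apply: is_derive_eq; rewrite /GRing.scale/=; ring. Qed.

Let continuous_expR_half M : continuous (fun t => M * expR (- (t / 2))).
Proof.
move=> t; apply/differentiable_continuous/derivable1_diffP.
by have [] := is_derive_expR_half M t.
Qed.

Let integral_expR_half M : 0 <= M ->
  (\int[mu]_(t in `[0%R, +oo[) (M * expR (- (t / 2)))%:E = (2 * M)%:E)%E.
Proof.
move=> M0; rewrite (@ge0_continuous_FTC2y _ _
  (fun t => - (2 * M) * expR (- (t / 2))) 0 0).
- by rewrite mul0r oppr0 expR0 mulr1 -EFinB sub0r opprK.
- by move=> t _; rewrite mulr_ge0 ?expR_ge0.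
- by apply: continuous_subspaceT; exact: continuous_expR_half.
- exact: cvg_expR_half.
- by move=> t _; have [] := is_derive_expR_half (- (2 * M)) t.
- by apply: cvg_at_right_filter; exact: continuous_expR_half.
- move=> t _; rewrite derive1E; have [_ ->] := is_derive_expR_half (- (2 * M)) t.
  by field.
Qed.

Let integrable_expR_half M : 0 <= M ->
  mu.-integrable `[0%R, +oo[ (EFin \o (fun t => M * expR (- (t / 2)))).
Proof.
move=> M0; apply/integrableP; split.
  apply/measurable_EFinP/measurable_funTS.
  by apply: continuous_measurable_fun; exact: continuous_expR_half.
under eq_integral do rewrite /= ger0_norm ?mulr_ge0 ?expR_ge0//.
by rewrite integral_expR_half// ltry.
Qed.

(** The majorants [M * expR (- (t / 2))] fit every [t `^ s * expR (- t)], with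
    [M] depending on [s], and their integrals are explicit. *)
Lemma dominated_integrable (f : R -> R) M :
  measurable_fun (`[0, +oo[ : set R) f ->
  (forall t, 0 <= t -> `|f t| <= M * expR (- (t / 2))) ->
  mu.-integrable `[0%R, +oo[ (EFin \o f).
Proof.
move=> mf fM.
have M0 : 0 <= M.
  by have := le_trans (normr_ge0 _) (fM _ (lexx 0)); rewrite mul0r oppr0 expR0 mulr1.
apply: le_integrable (integrable_expR_half _ M0) => //.
  exact/measurable_EFinP.
move=> t /=; rewrite in_itv/= andbT => t0; rewrite lee_fin (le_trans (fM _ t0))//.
exact: ler_norm.
Qed.

Lemma within_continuous_measurable (f : R -> R) :
  {within `[0%R, +oo[, continuous f} -> measurable_fun (`[0, +oo[ : set R) f.
Proof. exact: subspace_continuous_measurable_fun. Qed.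

(** For a nonnegative integrand this is [Rintegral_ge0_continuous_FTC2y]. Adding
    the majorant to [f] makes it nonnegative, and the integral of the majorant
    is subtracted afterwards. *)
Lemma dominated_FTC2y (f F : R -> R) M :
  {within `[0%R, +oo[, continuous f} ->
  (forall t, 0 <= t -> `|f t| <= M * expR (- (t / 2))) ->
  F t @[t --> +oo] --> (0 : R) ->
  (forall t, 0 < t -> is_derive t 1 F (f t)) ->
  F t @[t --> 0^'+] --> F 0 ->
  \int[mu]_(t in `[0%R, +oo[) f t = - F 0.
Proof.
move=> cf fM Fy dF F0.
have M0 : 0 <= M.
  by have := le_trans (normr_ge0 _) (fM _ (lexx 0)); rewrite mul0r oppr0 expR0 mulr1.
have iF := dominated_integrable _ _ (within_continuous_measurable _ cf) fM.
pose e t := M * expR (- (t / 2)).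
(* E is the primitive of e that vanishes at infinity *)
pose E t := - (2 * M) * expR (- (t / 2)).
have dE t : is_derive t 1 E (e t).
  by apply: is_derive_eq (is_derive_expR_half (- (2 * M)) t) _; rewrite /e; field.
have -> : \int[mu]_(t in `[0%R, +oo[) f t =
    \int[mu]_(t in `[0%R, +oo[) ((f t + e t) - e t).
  by apply: eq_Rintegral => t _; rewrite addrK.
rewrite RintegralB//; last 2 first.
- exact: (integrableD _ iF (integrable_expR_half _ M0)).
- exact: integrable_expR_half.
have -> : \int[mu]_(t in `[0%R, +oo[) e t = 2 * M.
  by rewrite /Rintegral integral_expR_half.
rewrite (@Rintegral_ge0_continuous_FTC2y _ _ (F \+ E) 0 (0 + 0)).
- by rewrite /= /E mul0r oppr0 expR0; ring.
- move=> t t0; have := fM _ t0; rewrite ler_norml => /andP[+ _].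
  by rewrite /e; lra.
- move=> t; apply: cvgD; first exact: cf.
  by apply: continuous_subspaceT; exact: continuous_expR_half.
- by apply: cvgD => //; exact: cvg_expR_half.
- by move=> t t0; apply: derivableD; [have [] := dF _ t0|have [] := dE t].
- apply: cvgD => //; apply: cvg_at_right_filter; exact: continuous_expR_half.
- move=> t; rewrite in_itv/= andbT => t0; rewrite derive1E.
  by have dFt := dF _ t0; have dEt := dE t; rewrite derive_val.
Qed.

End gamma.

(** * The Gamma function: functional equation *)

Section gamma_function.
Context {R : realType}.
Implicit Types (s t c r x y : R) (n : nat).
Notation mu := (@lebesgue_measure R).

Let g s t : R := t `^ s * expR (- t).

Let g_ge0 s t : 0 <= g s t.
Proof. by rewrite mulr_ge0 ?powR_ge0 ?expR_ge0. Qed.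

(** With [c = 2 * s + 1], the inequality [t / c <= expR (t / c)] raised to the
    power [s] gives [(t / c) `^ s <= expR (s * t / c) <= expR (t / 2)]. *)
Lemma powR_expR_le s t : 0 <= s -> 0 <= t ->
  t `^ s * expR (- t) <= (2 * s + 1) `^ s * expR (- (t / 2)).
Proof.
move=> s0 t0; have c0 : 0 < 2 * s + 1 by lra.
have -> : t `^ s = (2 * s + 1) `^ s * (t / (2 * s + 1)) `^ s.
  by rewrite -powRM ?divr_ge0 ?(ltW c0)// mulrC divfK// gt_eqF.
rewrite -mulrA ler_wpM2l ?powR_ge0//.
have tc0 : 0 <= t / (2 * s + 1) by rewrite divr_ge0 // ltW.
have : (t / (2 * s + 1)) `^ s <= expR (t / 2).
  apply: (@le_trans _ _ (expR (t / (2 * s + 1)) `^ s)).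
    apply: ge0_ler_powR; rewrite // ?nnegrE ?expR_ge0//.
    by apply: le_trans (expR_ge1Dx _); rewrite lerDr.
  rewrite -expRM ler_expR mulrAC ler_pdivrMr//; nra.
have -> : - (t / 2) = t / 2 + - t by field.
by rewrite expRD ler_pM2r// expR_gt0.
Qed.

Let is_derive_g s t : 0 < t ->
  is_derive t 1 (g (s + 1)) ((s + 1) * g s t - g (s + 1) t).
Proof.
move=> t0; have dp := is_derive1_powR (s + 1) t0.
by apply: is_derive_eq; rewrite /GRing.scale/= addrK /g; ring.
Qed.

Let cvg_g0 s : 0 <= s -> g s t @[t --> 0^'+] --> g s 0.
Proof.
move=> s0; apply: cvgM; last first.
  apply: cvg_at_right_filter; apply: continuous_comp; last exact: continuous_expR.
  exact: continuousN.
have [->|sn0] := eqVneq s 0.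
  by under eq_fun do rewrite powRr0; rewrite powRr0; exact: cvg_cst.
by rewrite powR0//; apply: powR_cvg0; rewrite lt_neqAle eq_sym sn0.
Qed.

Let continuous_g s : 0 <= s -> {within `[0%R, +oo[, continuous (g s)}.
Proof.
move=> s0; apply/continuous_within_itvcyP; split; last exact: cvg_g0.
move=> t; rewrite in_itv/= andbT => t0.
have := is_derive_g (s - 1) t t0; rewrite subrK => -[dg _].
exact/differentiable_continuous/derivable1_diffP.
Qed.

Let norm_g_le s t : 0 <= s -> 0 <= t ->
  `|g s t| <= (2 * s + 1) `^ s * expR (- (t / 2)).
Proof. by move=> s0 t0; rewrite ger0_norm ?g_ge0// powR_expR_le. Qed.

Let integrable_gc s : 0 <= s -> mu.-integrable `[0%R, +oo[ (EFin \o g s).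
Proof.
move=> s0; apply: dominated_integrable => [|t]; last exact: norm_g_le.
by apply: within_continuous_measurable; exact: continuous_g.
Qed.

Lemma integrable_gamma s : 0 <= s ->
  mu.-integrable `]0%R, +oo[ (EFin \o (fun t => t `^ s * expR (- t))).
Proof.
move=> s0; apply: integrableS (integrable_gc _ s0) => //.
by move=> t /=; rewrite !in_itv/= !andbT; exact: ltW.
Qed.

Lemma GammaE s : 
  Gamma (s + 1) = \int[mu]_(t in `]0%R, +oo[) (t `^ s * expR (- t)).
Proof. by rewrite /Gamma addrK. Qed.

Let GammaEc s : 0 <= s -> Gamma (s + 1) = \int[mu]_(t in `[0%R, +oo[) g s t.
Proof.
by move=> s0; rewrite GammaE Rintegral_itv_obnd_cbnd//; exact: integrable_gamma.
Qed.

(** Integrate the derivative [(s + 1) * t `^ s * expR (- t) -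
    t `^ (s + 1) * expR (- t)] of [t `^ (s + 1) * expR (- t)], which vanishes
    at both ends. *)
Lemma GammaS s : 0 <= s -> Gamma (s + 1 + 1) = (s + 1) * Gamma (s + 1).
Proof.
move=> s0; have s10 : 0 <= s + 1 by rewrite addr_ge0.
apply/esym/subr0_eq; rewrite !GammaEc//.
rewrite -RintegralZl//; last exact: integrable_gc.
rewrite -RintegralB//; last 2 first.
- have := integrableZl _ (s + 1) (integrable_gc _ s0).
  exact.
- exact: integrable_gc.
pose M := (s + 1) * (2 * s + 1) `^ s + (2 * (s + 1) + 1) `^ (s + 1).
have g00 : - g (s + 1) 0 = 0.
  by rewrite /g powR0 ?mul0r ?oppr0// gt_eqF// ltr_wpDl.
rewrite -[RHS]g00.
apply: (dominated_FTC2y (fun t => (s + 1) * g s t - g (s + 1) t) (g (s + 1)) M).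
- move=> t; apply: cvgB; last exact: continuous_g.
  by apply: cvgM; [exact: cvg_cst|exact: continuous_g].
- move=> t t0; rewrite (le_trans (ler_normB _ _))// /M [leRHS]mulrDl.
  apply: lerD; last exact: norm_g_le.
  by rewrite normrM (ger0_norm s10) -mulrA ler_wpM2l ?norm_g_le.
- apply: (@squeeze_cvgr _ _ _ _ (fun=> 0) 
    (fun t => (2 * (s + 1) + 1) `^ (s + 1) * expR (- (t / 2)))).
  + near=> t; rewrite g_ge0/= powR_expR_le//.
  + exact: cvg_cst.
  + exact: cvg_expR_half.
- by move=> t t0; exact: is_derive_g.
- exact: cvg_g0.
Unshelve. all: by end_near. Qed.

End gamma_function.

(** * The Gamma function: bounds *)

Section gamma_bounds.
Context {R : realType}.
Implicit Types (s t c r x y M : R) (n : nat).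
Notation mu := (@lebesgue_measure R).

(* Bernoulli's inequality u ^ (1 + s) >= 1 + (1 + s) (u - 1) for u = x / y,
   without division: the graph of the (s + 1)-th power lies above its tangent
   at y. *)
Let powR_tangent x y s : 0 < x -> 0 < y -> 0 <= s ->
  y `^ s * ((1 + s) * x - s * y) <= x `^ s * x.
Proof.
move=> x0 y0 s0; have u0 : 0 < x / y by rewrite divr_gt0.
have -> : x `^ s = y `^ s * (x / y) `^ s.
  by rewrite -powRM ?(ltW y0) ?(ltW u0)// mulrC divfK// gt_eqF.
rewrite -mulrA ler_wpM2l ?powR_ge0//.
have -> : x = x / y * y by rewrite divfK// gt_eqF.
rewrite mulfK ?gt_eqF//; set u := x / y in u0 *.
have -> : (1 + s) * (u * y) - s * y = ((1 + s) * u - s) * y by ring.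
rewrite [u `^ s * _]mulrA ler_wpM2r ?(ltW y0)//.
have lnu : 1 - u^-1 <= ln u.
  have uV0 : 0 < u^-1 by rewrite invr_gt0.
  have := @le_ln1Dx R (u^-1 - 1).
  have -> : 1 + (u^-1 - 1) = u^-1 by ring.
  rewrite lnV ?posrE// => /(_ _) lnu; have := lnu ltac:(lra); lra.
have : 1 + s * (1 - u^-1) <= u `^ s.
  rewrite /powR gt_eqF// (le_trans _ (expR_ge1Dx _))// lerD2l ler_wpM2l//.
move=> /(ler_wpM2r (ltW u0)).
suff -> : (1 + s * (1 - u^-1)) * u = (1 + s) * u - s by [].
by field; rewrite gt_eqF.
Qed.

Lemma Gamma1 : Gamma 1 = 1 :> R.
Proof.
have := GammaE (0 : R); rewrite add0r => ->.
rewrite Rintegral_itv_obnd_cbnd; last exact: integrable_gamma.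
under eq_Rintegral do rewrite powRr0 mul1r.
rewrite (@Rintegral_ge0_continuous_FTC2y _ _ (fun t => - expR (- t)) 0 0).
- by rewrite oppr0 expR0; ring.
- by move=> t _; rewrite expR_ge0.
- apply: continuous_subspaceT => t.
  by apply: continuous_comp; [exact: continuousN|exact: continuous_expR].
- by rewrite -[X in _ --> X]oppr0; apply: cvgN; exact: cvgr_expR.
- move=> t _; exact: ex_derive.
- apply: cvgN; apply: cvg_at_right_filter.
  by apply: continuous_comp; [exact: continuousN|exact: continuous_expR].
- by move=> t _; rewrite derive1E derive_val; rewrite /GRing.scale/=; ring.
Qed.

(** Integrate the tangent inequality at [y = r], where [x] is the integration
    variable, against [t `^ (r - 1) * expR (- t)]. With this tangent
    point, [Gamma (r + 1) = r * Gamma r] collapses the lower bound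
    [r `^ s * ((1 + s) * Gamma (r + 1) - s * r * Gamma r)] to a single term. *)
Lemma Gamma_ratio_ge r s : 1 <= r -> 0 <= s ->
  r `^ s * Gamma (r + 1) <= Gamma (r + s + 1).
Proof.
move=> r1 s0; have r0 : 0 < r by lra.
have Gr : Gamma (r + 1) = r * Gamma r.
  by have := GammaS (r - 1); rewrite subrK; apply; lra.
have -> : r `^ s * Gamma (r + 1) = r `^ s * (1 + s) * Gamma (r + 1)
    - r `^ s * (s * r) * Gamma (r - 1 + 1).
  by rewrite subrK Gr; ring.
rewrite !GammaE -!RintegralZl//; last 2 first.
- by apply: integrable_gamma; lra.
- by apply: integrable_gamma; lra.
have i1 := integrable_gamma r (ltW r0).
have r1' : 0 <= r - 1 by lra.
have i2 := integrable_gamma (r - 1) r1'.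
rewrite -RintegralB//; last 2 first.
- exact: (integrableZl _ (r `^ s * (1 + s)) i1).
- exact: (integrableZl _ (r `^ s * (s * r)) i2).
apply: le_Rintegral => //.
- exact: (integrableB _ (integrableZl _ (r `^ s * (1 + s)) i1)
                        (integrableZl _ (r `^ s * (s * r)) i2)).
- by apply: integrable_gamma; lra.
move=> t /=; rewrite in_itv/= andbT => t0.
have tr : t `^ r = t * t `^ (r - 1) by rewrite mulr_powRB1// ltW.
rewrite (@powRD _ t r s); last by rewrite (gt_eqF t0) implybT.
rewrite tr; have := powR_tangent t r s t0 r0 s0.
have e0 : 0 <= t `^ (r - 1) * expR (- t) by rewrite mulr_ge0 ?powR_ge0 ?expR_ge0.
move=> /(ler_wpM2r e0). lra.
Qed.

(** The same tangent inequality with the two points exchanged, the fixed one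
    being [r + s + 1], integrated against [t `^ r * expR (- t)]. *)
Lemma Gamma_ratio_le r s : 0 <= r -> 0 <= s ->
  Gamma (r + s + 1) <= (r + s + 1) `^ s * Gamma (r + 1).
Proof.
move=> r0 s0; set c := r + s + 1; have c0 : 0 < c by rewrite /c; lra.
have rs0 : 0 <= r + s by lra.
have Gc : Gamma (r + s + 1 + 1) = c * Gamma c by rewrite GammaS.
rewrite -(ler_pM2l c0).
have -> : c * Gamma c = (1 + s) * c * Gamma (r + s + 1) - s * Gamma (r + s + 1 + 1).
  by rewrite Gc /c; ring.
rewrite mulrA !GammaE -!RintegralZl//; last 3 first.
- exact: integrable_gamma.
- by apply: integrable_gamma; lra.
- by apply: integrable_gamma; lra.
have i1 := integrable_gamma (r + s) rs0.
have i2 := integrable_gamma (r + s + 1) (ltW c0).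
rewrite -RintegralB//; last 2 first.
- exact: (integrableZl _ ((1 + s) * c) i1).
- exact: (integrableZl _ s i2).
apply: le_Rintegral => //.
- exact: (integrableB _ (integrableZl _ ((1 + s) * c) i1) (integrableZl _ s i2)).
- exact: (integrableZl _ (c * c `^ s) (integrable_gamma r r0)).
move=> t /=; rewrite in_itv/= andbT => t0.
have tn0 : t != 0 by rewrite gt_eqF.
rewrite !powRD ?tn0 ?implybT// powRr1 ?(ltW t0)//.
have := powR_tangent c t s c0 t0 s0.
have e0 : 0 <= t `^ r * expR (- t) by rewrite mulr_ge0 ?powR_ge0 ?expR_ge0.
move=> /(ler_wpM2r e0). lra.
Qed.

Lemma Gamma_gt0 s : 0 <= s -> 0 < Gamma (s + 1).
Proof.
move=> s0; have s10 : 0 < s + 1 by lra.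
have := Gamma_ratio_ge 1 s (lexx 1) s0.
rewrite powR1 mul1r; have := GammaS (0 : R) (lexx 0); rewrite !add0r Gamma1 mulr1 => ->.
by rewrite [1 + s]addrC GammaS// => /(lt_le_trans ltr01); rewrite pmulr_rgt0.
Qed.

(** Keep only the part [t >= M] of the integral. The freedom in [M] makes this
    both a geometric lower bound with any ratio ([M] fixed) and a bound in the
    style of Stirling ([M = s]). *)
Lemma Gamma_ge s M : 0 <= s -> 0 < M -> M `^ s * expR (- M) <= Gamma (s + 1).
Proof.
move=> s0 M0; have ig := integrable_gamma _ s0.
have sub : `[M, +oo[ `<=` (`]0, +oo[ : set R).
  by move=> t /=; rewrite !in_itv/= !andbT; exact: lt_le_trans.
have mg := measurable_int _ ig.
rewrite GammaE -lee_fin fineK; last exact: integrable_fin_num.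
have cE (c : R) : continuous (fun t : R => c * expR (- t)).
  move=> t; apply: cvgM; first exact: cvg_cst.
  by apply: continuous_comp; [exact: continuousN|exact: continuous_expR].
have -> : ((M `^ s * expR (- M))%:E =
    \int[mu]_(t in `[M, +oo[) (M `^ s * expR (- t))%:E)%E.
  rewrite (@ge0_continuous_FTC2y _ _ (fun t => - M `^ s * expR (- t)) M 0).
  - by rewrite -EFinB sub0r mulNr opprK.
  - by move=> t _; rewrite mulr_ge0 ?powR_ge0 ?expR_ge0.
  - by apply: continuous_subspaceT; exact: cE.
  - by rewrite -[X in _ --> X](mulr0 (- M `^ s)); apply: cvgM;
      [exact: cvg_cst|exact: cvgr_expR].
  - by move=> t _; exact: ex_derive.
  - by apply: cvg_at_right_filter; exact: cE.
  - by move=> t _; rewrite derive1E derive_val; rewrite /GRing.scale/=; ring.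
apply: (@le_trans _ _ (\int[mu]_(t in `[M, +oo[) (t `^ s * expR (- t))%:E)%E).
  apply: ge0_le_integral => //.
  - by move=> t _; rewrite lee_fin mulr_ge0 ?powR_ge0 ?expR_ge0.
  - apply/measurable_EFinP/measurable_funTS.
    by apply: continuous_measurable_fun; exact: cE.
  - exact: measurable_funS mg.
  - move=> t /=; rewrite in_itv/= andbT => Mt.
    rewrite lee_fin ler_wpM2r ?expR_ge0// ge0_ler_powR// nnegrE ltW//.
    exact: lt_le_trans Mt.
apply: ge0_subset_integral => // t _.
by rewrite lee_fin mulr_ge0 ?powR_ge0 ?expR_ge0.
Qed.

Lemma Gamma_nat n s : 0 <= s ->
  Gamma (n%:R + s + 1) = n`!%:R * negbin (s + 1) n * Gamma (s + 1).
Proof.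
move=> s0; elim: n => [|n IH]; first by rewrite negbin0 add0r !mul1r.
have -> : n.+1%:R + s + 1 = n%:R + s + 1 + 1 by rewrite -natr1; ring.
rewrite GammaS ?addr_ge0// IH factS natrM -!mulrA [n.+1%:R * _]mulrCA.
rewrite [n.+1%:R * _]mulrA negbinS; ring.
Qed.

(** Together with the next lemma, this is Gauss's limit
    [n ^ s n! / ((s + 1) ... (s + n)) --> Gamma (s + 1)] in quantitative form,
    since [negbin (s + 1) n = Gamma (n + s + 1) / (n! Gamma (s + 1))]. *)
Lemma negbin_Gamma_ge s n : (0 < n)%N -> 0 <= s ->
  n%:R `^ s <= negbin (s + 1) n * Gamma (s + 1).
Proof.
move=> n1 s0; have n0 : 0 < n`!%:R :> R by rewrite ltr0n fact_gt0.
rewrite -(ler_pM2l n0) mulrA -Gamma_nat//.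
have := Gamma_nat n 0 (lexx 0); rewrite addr0 add0r negbin1 Gamma1 !mulr1 => <-.
by rewrite mulrC Gamma_ratio_ge ?ler1n.
Qed.

Lemma negbin_Gamma_le s n : 0 <= s ->
  negbin (s + 1) n * Gamma (s + 1) <= (n%:R + s + 1) `^ s.
Proof.
move=> s0; have n0 : 0 < n`!%:R :> R by rewrite ltr0n fact_gt0.
rewrite -(ler_pM2l n0) mulrA -Gamma_nat//.
have := Gamma_nat n 0 (lexx 0); rewrite addr0 add0r negbin1 Gamma1 !mulr1 => <-.
by rewrite mulrC Gamma_ratio_le.
Qed.

End gamma_bounds.

(** * Exchange of limits and series *)

Section tannery.
Context {R : realType}.
Implicit Types (f g : nat -> R) (C : R) (k K m : nat).

(* The exact factor 1 - 2 ^ (- m) makes the induction on m go through. *)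
Let half_tail f C K m : (forall k, `|f k| <= C * 2^-1 ^+ k) ->
  `|series f (K + m)%N - series f K| <= 2 * C * 2^-1 ^+ K * (1 - 2^-1 ^+ m).
Proof.
move=> fC; elim: m => [|m IH].
  by rewrite addn0 subrr normr0 expr0 subrr mulr0.
rewrite addnS seriesSr.
have -> : series f (K + m)%N + f (K + m)%N - series f K =
    (series f (K + m)%N - series f K) + f (K + m)%N by ring.
apply: le_trans (ler_normD _ _) _; have := fC (K + m)%N.
rewrite exprS exprD; set u := 2^-1 ^+ K in IH *; set v := 2^-1 ^+ m in IH *.
move=> h; apply: (le_trans (lerD IH h)); rewrite le_eqVlt; apply/orP; left.
by apply/eqP; field.
Qed.

Lemma half_cvg_series f C : (forall k, `|f k| <= C * 2^-1 ^+ k) -> cvgn (series f).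
Proof.
move=> fC; apply: normed_cvg.
apply: (@series_le_cvg _ _ (fun k => C * 2^-1 ^+ k)).
- by move=> k /=.
- by move=> k; exact: le_trans (normr_ge0 _) (fC k).
- exact: fC.
- by apply: is_cvg_geometric_series; rewrite ger0_norm ?invf_lt1// ltr1n.
Qed.

Lemma half_series_tail f C K : (forall k, `|f k| <= C * 2^-1 ^+ k) ->
  `|limn (series f) - series f K| <= 2 * C * 2^-1 ^+ K.
Proof.
move=> fC; have C0 : 0 <= C.
  by have := le_trans (normr_ge0 _) (fC 0%N); rewrite expr0 mulr1.
have cf : (fun m => `|series f (m + K)%N - series f K|) @ \oo -->
    `|limn (series f) - series f K|.
  apply: cvg_norm; apply: cvgB; last exact: cvg_cst.
  by rewrite (cvg_shiftn K (series f)); exact: half_cvg_series fC.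
apply: (cvgr_to_le cf).
near=> m; rewrite addnC (le_trans (half_tail _ _ _ _ fC))//.
rewrite ler_piMr ?mulr_ge0 ?exprn_ge0 ?invr_ge0//.
Unshelve. all: by end_near. Qed.

(** Dominated convergence for series, along an arbitrary filter: it serves both
    for a limit in an index and for continuity in a variable. The majorant is
    taken geometric of ratio one half, which keeps the tail estimate
    elementary. *)
Lemma tannery (T : Type) (F : set_system T) (FF : ProperFilter F)
    (f : T -> nat -> R) (g : nat -> R) C :
  (\forall t \near F, forall k, `|f t k| <= C * 2^-1 ^+ k) ->
  (forall k, f t k @[t --> F] --> g k) ->
  limn (series (f t)) @[t --> F] --> limn (series g).
Proof.
move=> fC fg.
have gC k : `|g k| <= C * 2^-1 ^+ k.
  apply: (cvgr_to_le (cvg_norm (fg k))).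
  by apply: filterS fC => t /(_ k).
have C0 : 0 <= C.
  by have := le_trans (normr_ge0 _) (gC 0%N); rewrite expr0 mulr1.
apply/cvgrPdist_le => e e0.
have [K Ke] : exists K, 2 * C * 2^-1 ^+ K <= e / 4.
  have : geometric (2 * C) 2^-1 @ \oo --> (0 : R).
    by apply: cvg_geometric; rewrite ger0_norm ?invf_lt1// ltr1n.
  move/cvgr_le => /(_ (e / 4) ltac:(lra)) [K _ /(_ K (leqnn K)) h].
  by exists K.
have sK : series (f t) K @[t --> F] --> series g K.
  rewrite /series/=; apply: cvg_big => // [[x y]]; exact: add_continuous.
have {}sK := (@cvgrPdist_le _ _ _ _ _ _ _).1 sK (e / 2) ltac:(lra).
near=> t.
have ft : forall k, `|f t k| <= C * 2^-1 ^+ k by near: t.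
have h1 := half_series_tail _ _ K ft.
have h2 := half_series_tail _ _ K gC.
have h3 : `|series g K - series (f t) K| <= e / 2 by near: t.
have -> : limn (series g) - limn (series (f t)) =
  (limn (series g) - series g K) + (series g K - series (f t) K)
  - (limn (series (f t)) - series (f t) K) by ring.
apply: le_trans (ler_normB _ _) _; apply: le_trans (lerD (ler_normD _ _) (lexx _)) _.
lra.
Unshelve. all: by end_near. Qed.

End tannery.

(** * The Mittag-Leffler function on the negative half line *)

Section mittag_leffler.
Context {R : realType}.
Implicit Types (a s x l : R) (n k N j : nat).

(* The base of the geometric majorants below: the s-th power of e3 N, up to a
   factor depending on N only, dominates both 1 / Gamma (s + 1) and
   negbin (s + 1) n / n ^ s, for all n >= N > 0 and s >= 0. *)
Let e3 N : R := 3 * expR 1 / N%:R.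

Let e3_ge0 N : 0 <= e3 N.
Proof. by rewrite /e3 divr_ge0 ?mulr_ge0 ?expR_ge0. Qed.

(* By negbin_Gamma_le, the quotient by n ^ s is at most
   ((n + s + 1) / n) ^ s / Gamma (s + 1). If s <= N the first factor is at most
   3 ^ s, and Gamma_ge is used with M = N; otherwise it is at most
   (3 s / N) ^ s, and the choice M = s in Gamma_ge cancels s ^ s. *)
Let negbin_le s n N : 0 <= s -> (0 < N <= n)%N ->
  negbin (s + 1) n <= n%:R `^ s * (expR N%:R * e3 N `^ s).
Proof.
move=> s0 /andP[N0 Nn].
have N1 : 1 <= N%:R :> R by rewrite ler1n.
have Np : 0 < N%:R :> R by rewrite ltr0n.
have NnR : N%:R <= n%:R :> R by rewrite ler_nat.
have n0 : 0 < n%:R :> R by exact: lt_le_trans NnR.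
have G0 := Gamma_gt0 _ s0.
have ub := negbin_Gamma_le _ n s0.
rewrite -(ler_pM2r G0); apply: le_trans ub _.
have -> : n%:R + s + 1 = n%:R * ((n%:R + s + 1) / n%:R) :> R.
  by rewrite mulrC divfK// gt_eqF.
have q0 : 0 <= (n%:R + s + 1) / n%:R :> R by rewrite divr_ge0//; lra.
rewrite powRM// ?(ltW n0)// -mulrA ler_wpM2l ?powR_ge0//.
have [sN|Ns] := leP s N%:R.
  have q3 : (n%:R + s + 1) / n%:R <= 3 by rewrite ler_pdivrMr//; lra.
  apply: (@le_trans _ _ (3 `^ s)); first by rewrite ge0_ler_powR// nnegrE.
  have G := Gamma_ge s N%:R s0 Np.
  have : expR N%:R * e3 N `^ s * (N%:R `^ s * expR (- N%:R)) <=
      expR N%:R * e3 N `^ s * Gamma (s + 1).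
    by rewrite ler_wpM2l// mulr_ge0 ?expR_ge0 ?powR_ge0.
  apply: le_trans.
  rewrite expRN; have -> : expR N%:R * e3 N `^ s * (N%:R `^ s / expR N%:R) =
     e3 N `^ s * N%:R `^ s by field; rewrite gt_eqF// expR_gt0.
  rewrite -powRM ?e3_ge0// /e3 divfK ?gt_eqF//.
  rewrite ge0_ler_powR// ?nnegrE ?mulr_ge0 ?expR_ge0//.
  by have := @expR_ge1Dx R 1; lra.
have sp : 0 < s by exact: lt_trans Ns.
have q3 : (n%:R + s + 1) / n%:R <= 3 * s / N%:R.
  rewrite ler_pdivrMr// mulrAC ler_pdivlMr//.
  have s1 : 1 <= s by lra.
  have := ler_wpM2l (ltW n0) (ltW Ns); have := ler_wpM2l (ltW sp) NnR.
  have := ler_wpM2l (ltW n0) s1; nra.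
apply: (@le_trans _ _ ((3 * s / N%:R) `^ s)).
  by rewrite ge0_ler_powR// nnegrE// (le_trans q0).
have G := Gamma_ge s s s0 sp.
have : expR N%:R * e3 N `^ s * (s `^ s * expR (- s)) <=
      expR N%:R * e3 N `^ s * Gamma (s + 1).
  by rewrite ler_wpM2l// mulr_ge0 ?expR_ge0 ?powR_ge0.
apply: le_trans.
rewrite -[leRHS]mulrA -[leLHS]mul1r ler_pM//.
- exact: powR_ge0.
- by have := @expR_ge1Dx R N%:R; lra.
have -> : 3 * s / N%:R = e3 N * s * expR (- 1).
  by rewrite /e3 expRN; field; rewrite !gt_eqF ?expR_gt0.
rewrite -[- s]mulN1r expRM !powRM ?mulr_ge0 ?expR_ge0//.
by rewrite mulrA.
Qed.

Let invGamma_le s N : 0 <= s -> (0 < N)%N ->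
  (Gamma (s + 1))^-1 <= expR N%:R * e3 N `^ s.
Proof.
move=> s0 N0; have G0 := Gamma_gt0 _ s0.
have Np : 0 < N%:R `^ s :> R by rewrite powR_gt0// ltr0n.
have h1 := negbin_Gamma_ge _ _ N0 s0.
have h2 : negbin (s + 1) N <= N%:R `^ s * (expR N%:R * e3 N `^ s).
  by apply: negbin_le => //; rewrite N0 leqnn.
rewrite -(ler_pM2l Np) (le_trans _ h2)//.
by rewrite ler_pdivrMr.
Qed.

(* As e3 N tends to 0, the ratio l (e3 N) ^ a can be made at most one half. *)
Let exists_N a l : 0 < a -> 0 <= l ->
  exists2 N, (0 < N)%N & l * e3 N `^ a <= 2^-1.
Proof.
move=> a0 l0; have l1 : 0 < 2 * l + 1 by lra.
pose L := 3 * expR 1 * (2 * l + 1) `^ a^-1.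
have L0 : 0 < L by rewrite !mulr_gt0 ?expR_gt0 ?powR_gt0.
have [N LN] : exists N, L <= N%:R.
  by exists (Num.bound L); rewrite (le_trans _ (ltW (archi_boundP _)))// ltW.
have N0 : 0 < N%:R :> R by exact: lt_le_trans LN.
exists N; first by rewrite -(@ltr0n R).
have : e3 N <= ((2 * l + 1) `^ a^-1)^-1.
  rewrite /e3 ler_pdivrMr// ler_pdivlMl ?powR_gt0//.
  by rewrite mulrC.
move=> /(ge0_ler_powR (ltW a0) _ _) h.
have {}h : e3 N `^ a <= (2 * l + 1)^-1.
  apply: le_trans (h _ _) _; rewrite ?nnegrE ?e3_ge0 ?invr_ge0 ?powR_ge0//.
  by rewrite -powRN -powRrM mulNr mulVf ?gt_eqF// powR_inv1 ?(ltW l1).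
apply: le_trans (ler_wpM2l l0 h) _.
by rewrite ler_pdivrMr//; lra.
Qed.

Let geometric_bound a l N k : 0 < a -> 0 <= l -> l * e3 N `^ a <= 2^-1 ->
  l ^+ k * (expR N%:R * e3 N `^ (a * k%:R)) <= expR N%:R * 2^-1 ^+ k.
Proof.
move=> a0 l0 h.
rewrite powRrM powR_mulrn ?powR_ge0// mulrCA -exprMn.
rewrite ler_wpM2l ?expR_ge0// lerXn2r// nnegrE ?invr_ge0//.
by rewrite mulr_ge0// powR_ge0.
Qed.

Let ML_term_le a l N x k : 0 < a -> 0 <= l -> (0 < N)%N ->
  l * e3 N `^ a <= 2^-1 -> `|x| <= l ->
  `|x ^+ k / Gamma (a * k%:R + 1)| <= expR N%:R * 2^-1 ^+ k.
Proof.
move=> a0 l0 N0 h xl; have ak0 : 0 <= a * k%:R by rewrite mulr_ge0// ltW.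
have G0 := Gamma_gt0 _ ak0.
rewrite normrM normrX normfV (gtr0_norm G0).
apply: le_trans (geometric_bound a l N k a0 l0 h).
apply: ler_pM; rewrite ?exprn_ge0 ?invr_ge0 ?(ltW G0)//.
  by rewrite lerXn2r// nnegrE.
exact: invGamma_le.
Qed.

Lemma ML_cvg a x : 0 < a ->
  cvgn (series (fun k => x ^+ k / Gamma (a * k%:R + 1))).
Proof.
move=> a0; have [N N0 h] := exists_N a `|x| a0 (normr_ge0 x).
apply: (half_cvg_series _ (expR N%:R)) => k.
exact: (ML_term_le a `|x| N).
Qed.

Lemma continuous_ML a : 0 < a -> continuous (ML a : R -> R).
Proof.
move=> a0 x; have l0 : 0 <= `|x| + 1 by rewrite addr_ge0.
have [N N0 h] := exists_N a _ a0 l0.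
pose f (y : R) k := y ^+ k / Gamma (a * k%:R + 1).
apply: (tannery _ (nbhs x) _ f (f x) (expR N%:R)).
  near=> y => k; apply: (ML_term_le a (`|x| + 1) N) => //.
  rewrite -[y](subrK x) (le_trans (ler_normD _ _))// addrC lerD2l.
  by near: y; apply: (@cvgr_distC_le _ _ _ (nbhs x) _ id x) => //; exact: cvg_id.
move=> k; rewrite /f; apply: cvgM; last exact: cvg_cst.
exact: exprn_continuous.
Unshelve. all: by end_near. Qed.

(** The terms are nonnegative, and the left-hand side is the sum of the first
    two. *)
Lemma ML_ge1 a x : 0 < a -> 0 <= x -> 1 + x / Gamma (a + 1) <= ML a x.
Proof.
move=> a0 x0.
have -> : 1 + x / Gamma (a + 1) = series (fun k => x ^+ k / Gamma (a * k%:R + 1)) 2.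
  rewrite /series/= !big_nat_recr//= big_geq// add0r mulr0n mulr0 add0r Gamma1.
  by rewrite mulr1 expr0 expr1 divr1.
apply: nondecreasing_cvgn_le; last exact: ML_cvg.
apply/nondecreasing_seqP => n; rewrite seriesSr lerDl.
by rewrite divr_ge0 ?exprn_ge0// ltW// Gamma_gt0// mulr_ge0// ltW.
Qed.

Let cvg_negbin s : 0 <= s ->
  (fun n => negbin (s + 1) n / n%:R `^ s) @ \oo --> (Gamma (s + 1))^-1.
Proof.
move=> s0; have G0 := Gamma_gt0 _ s0.
apply: (@squeeze_cvgr _ _ _ _ (fun=> (Gamma (s + 1))^-1)
   (fun n => (1 + (s + 1) * n%:R^-1) `^ s / Gamma (s + 1))).
- near=> n.
  have n0 : (0 < n)%N by near: n; exists 1%N.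
  have n0R : 0 < n%:R :> R by rewrite ltr0n.
  have np : 0 < n%:R `^ s :> R by rewrite powR_gt0.
  have h1 := negbin_Gamma_ge _ _ n0 s0.
  have h2 := negbin_Gamma_le _ n s0.
  apply/andP; split.
    by rewrite ler_pdivlMr// mulrC ler_pdivrMr.
  rewrite ler_pdivrMr// mulrAC ler_pdivlMr// (le_trans h2)//.
  rewrite -powRM ?(ltW n0R)//; last by rewrite addr_ge0// mulr_ge0 ?invr_ge0//; lra.
  rewrite le_eqVlt; apply/orP; left; apply/eqP; congr (_ `^ _).
  by field; rewrite gt_eqF.
- exact: cvg_cst.
rewrite -[X in _ --> X]mul1r; apply: cvgM; last exact: cvg_cst.
have lim1 : (fun n : nat => 1 + (s + 1) * n%:R^-1) @ \oo --> (1 + (s + 1) * 0 : R).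
  apply: cvgD; first exact: cvg_cst.
  apply: cvgM; first exact: cvg_cst.
  by rewrite -(cvg_shiftS (fun n : nat => (n%:R^-1 : R))); exact: cvg_harmonic.
have p1 : 0 < 1 + (s + 1) * 0 :> R by rewrite mulr0 addr0.
have cp : {for 1 + (s + 1) * 0 : R, continuous (fun x => x `^ s)}.
  have [dp _] := is_derive1_powR s p1.
  exact/differentiable_continuous/derivable1_diffP.
have := @cvg_comp _ _ _ _ (fun x => x `^ s) _ _ _ lim1 cp.
by rewrite mulr0 addr0 powR1.
Unshelve. all: by end_near. Qed.

Let negbin_leD1 s n j : 0 <= s -> (j <= n)%N -> negbin s j <= negbin (s + 1) n.
Proof.
move=> s0 jn; have jn' : (j < n.+1)%N by [].
rewrite negbinD1 (bigD1 (Ordinal jn'))//= lerDl.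
by apply: sumr_ge0 => i _; exact: negbin_ge0.
Qed.

(** Apply [resolvent_bound] with [mu = l / n ^ a]. The partial sum of [d] is the
    series of the terms [(- mu) ^ k * negbin (a k + 1) n], and each of these
    tends to [(- l) ^ k / Gamma (a k + 1)] as [n] grows, while [mu *
    negbin (a + 1) n] tends to [l / Gamma (a + 1)]. The bounds [geometric_bound]
    allow the exchange of the limit and the series. *)
Theorem ML_neg_le a l : 0 < a < 1 -> 0 <= l ->
  ML a (- l) * (1 + l / Gamma (a + 1)) <= 1.
Proof.
move=> a01 l0; have /andP[a0 _] := a01.
have [N N0 h] := exists_N a l a0 l0.
pose mu n : R := l / n%:R `^ a.
pose f (n k : nat) : R := (- mu n) ^+ k * negbin (a * k%:R + 1) n.
pose d (n j : nat) : R :=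
  limn (series (fun k => (- mu n) ^+ k * negbin (a * k%:R) j)).
have np n : (N <= n)%N -> 0 < n%:R `^ a :> R.
  by move=> Nn; rewrite powR_gt0// ltr0n (leq_trans N0).
have ak0 k : 0 <= a * k%:R by rewrite mulr_ge0// ltW.
have mu0 n : 0 <= mu n by rewrite divr_ge0// powR_ge0.
have dom n k : (N <= n)%N ->
    mu n ^+ k * negbin (a * k%:R + 1) n <= expR N%:R * 2^-1 ^+ k.
  move=> Nn; apply: le_trans (geometric_bound a l N k a0 l0 h).
  have -> : l ^+ k = mu n ^+ k * n%:R `^ (a * k%:R).
    by rewrite powRrM powR_mulrn ?powR_ge0// -exprMn divfK// gt_eqF// np.
  rewrite -mulrA ler_wpM2l ?exprn_ge0// negbin_le// N0//.
have domf n k : (N <= n)%N -> `|f n k| <= expR N%:R * 2^-1 ^+ k.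
  move=> Nn; rewrite normrM normrX normrN (ger0_norm (mu0 n)).
  by rewrite ger0_norm ?dom// negbin_ge0// addr_ge0.
have domd n j k : (N <= n)%N -> (j <= n)%N ->
    `|(- mu n) ^+ k * negbin (a * k%:R) j| <= expR N%:R * 2^-1 ^+ k.
  move=> Nn jn; rewrite normrM normrX normrN (ger0_norm (mu0 n)).
  apply: le_trans (dom n k Nn); rewrite ler_wpM2l ?exprn_ge0//.
  by rewrite ger0_norm ?negbin_leD1 ?negbin_ge0.
have dcvg n j : (N <= n)%N -> (j <= n)%N ->
    (fun K => \sum_(k < K) (- mu n) ^+ k * negbin (a * k%:R) j) @ \oo --> d n j.
  move=> Nn jn.
  have := half_cvg_series _ _ (fun k => domd n j k Nn jn).
  by rewrite /d seriesEord.
have fE n : (N <= n)%N -> limn (series (f n)) = \sum_(j < n.+1) d n j.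
  move=> Nn; apply/cvg_lim => //.
  rewrite seriesEord.
  have -> : (fun K => \sum_(k < K) f n k) =
      (fun K => \sum_(j < n.+1) \sum_(k < K) (- mu n) ^+ k * negbin (a * k%:R) j).
    apply/funext => K; rewrite exchange_big/=; apply: eq_bigr => k _.
    by rewrite /f negbinD1 mulr_sumr.
  apply: cvg_big => [[x y]|j _]; first exact: add_continuous.
  by apply: dcvg => //; rewrite -ltnS.
have bound n : (N <= n)%N ->
    limn (series (f n)) * (1 + l * (negbin (a + 1) n / n%:R `^ a)) <= 1.
  move=> Nn; rewrite fE//.
  have -> : l * (negbin (a + 1) n / n%:R `^ a) = mu n * negbin (a + 1) n.
    by rewrite /mu; ring.
  by apply: resolvent_bound => // j jn; exact: dcvg.
have flim : limn (series (f n)) @[n --> \oo] --> ML a (- l).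
  apply: (tannery _ \oo _ f _ (expR N%:R)).
    by exists N => // n /= Nn k; exact: domf.
  move=> k.
  have lim := cvg_negbin _ (ak0 k).
  have : (fun n => (- l) ^+ k *
      (negbin (a * k%:R + 1) n / n%:R `^ (a * k%:R))) @ \oo -->
      (- l) ^+ k / Gamma (a * k%:R + 1).
    by apply: cvgM; [exact: cvg_cst|exact: lim].
  apply: cvg_trans; apply: near_eq_cvg; exists N => // n /= Nn.
  rewrite /f /mu powRrM powR_mulrn ?powR_ge0// -mulNr exprMn exprVn.
  by ring.
have glim : (fun n => limn (series (f n)) *
    (1 + l * (negbin (a + 1) n / n%:R `^ a))) @ \oo -->
    ML a (- l) * (1 + l / Gamma (a + 1)).
  apply: cvgM => //; apply: cvgD; first exact: cvg_cst.
  by apply: cvgM; [exact: cvg_cst|apply: cvg_negbin; exact: ltW].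
by apply: (cvgr_to_le glim); exists N => // n /= Nn; exact: bound.
Qed.

End mittag_leffler.

(** * The function [phi] *)

Section phi.
Context {R : realType}.
Implicit Types (a u x y : R).

Lemma ML0 a : 0 < a < 1 -> ML a 0 = 1 :> R.
Proof.
move=> a01; have /andP[a0 _] := a01; apply/le_anti/andP; split.
  by have := ML_neg_le a 0 a01 (lexx 0); rewrite oppr0 mul0r addr0 mulr1.
by have := ML_ge1 a 0 a0 (lexx 0); rewrite mul0r addr0.
Qed.

Lemma ML_lt1 a x : 0 < a < 1 -> (ML a x < 1) = (x < 0).
Proof.
move=> a01; have /andP[a0 _] := a01; have G0 := Gamma_gt0 a (ltW a0).
apply/idP/idP => [|x0].
  apply: contraTT; rewrite -!leNgt => x0; apply: le_trans (ML_ge1 a x a0 x0).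
  by rewrite lerDl divr_ge0// ltW.
have := ML_neg_le a (- x) a01; rewrite opprK oppr_ge0 => /(_ (ltW x0)).
have : 0 < - x / Gamma (a + 1) by rewrite divr_gt0// oppr_gt0.
nra.
Qed.

Lemma ML_eq1 a x : 0 < a < 1 -> ML a x = 1 -> x = 0.
Proof.
move=> a01 x1; have /andP[a0 _] := a01; have G0 := Gamma_gt0 a (ltW a0).
have x0 : 0 <= x by rewrite leNgt -(ML_lt1 a)// x1 ltxx.
apply/eqP; rewrite eq_le x0 andbT leNgt; apply/negP => xp.
have := ML_ge1 a x a0 x0; rewrite x1.
have : 0 < x / Gamma (a + 1) by rewrite divr_gt0.
lra.
Qed.

(** By [ML_neg_le] the value at [- l] is at most
    [1 / (1 + l / Gamma (a + 1))], which is below [u] for [l] large, and the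
    value at [0] is [1]. *)
Lemma ML_surj a u : 0 < a < 1 -> 0 < u <= 1 -> exists x, ML a x = u.
Proof.
move=> a01 /andP[u0 u1]; have /andP[a0 _] := a01.
have G0 := Gamma_gt0 a (ltW a0).
(* with this l the bound is 1 / (1 + 1 / u) <= u *)
pose l := Gamma (a + 1) / u; have l0 : 0 <= l by rewrite divr_ge0 ?ltW.
have El : ML a (- l) <= u.
  have := ML_neg_le a l a01 l0.
  have -> : l / Gamma (a + 1) = u^-1 by rewrite /l; field; rewrite !gt_eqF.
  rewrite -ler_pdivlMr ?addr_gt0 ?invr_gt0// div1r => /le_trans; apply.
  rewrite -[leRHS]invrK lef_pV2 ?posrE ?addr_gt0 ?invr_gt0//.
  by rewrite lerDr.
have cE : {within `[- l, 0], continuous (ML a)}.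
  by apply: continuous_subspaceT; exact: continuous_ML.
have l0' : - l <= 0 by rewrite oppr_le0.
have uE : Num.min (ML a (- l)) (ML a 0) <= u <= Num.max (ML a (- l)) (ML a 0).
  by rewrite ML0// ge_min El le_max u1 orbT.
by have [x _ xu] := IVT l0' cE uE; exists x.
Qed.

Lemma ML_lnK a u : 0 < a < 1 -> 0 < u <= 1 -> ML a (ML_ln a u) = u.
Proof.
move=> a01 u01; rewrite /ML_ln pinvK// inE.
by have [x xu] := ML_surj a u a01 u01; exists x.
Qed.

Lemma ML_ln_lt0 a u : 0 < a < 1 -> 0 < u < 1 -> ML_ln a u < 0.
Proof.
by move=> a01 /andP[u0 u1]; rewrite -(ML_lt1 a)// ML_lnK// u0 (ltW u1).
Qed.

Lemma phi0 a : phi a 0 = 0 :> R.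
Proof. by rewrite /phi mul0r. Qed.

Lemma phi1 a : 0 < a < 1 -> phi a 1 = 0 :> R.
Proof.
move=> a01; have /andP[a0 _] := a01.
rewrite /phi (ML_eq1 a (ML_ln a 1))// ?ML_lnK ?ltr01 ?lexx//.
by rewrite oppr0 powR0 ?mulr0// invr_eq0 gt_eqF.
Qed.

Lemma phi_ge0 a u : 0 <= u -> 0 <= phi a u.
Proof. by move=> u0; rewrite mulr_ge0// powR_ge0. Qed.

Lemma phi_gt0 a u : 0 < a < 1 -> 0 < u < 1 -> 0 < phi a u.
Proof.
move=> a01 u01; have /andP[u0 _] := u01.
by rewrite mulr_gt0// powR_gt0// oppr_gt0 ML_ln_lt0.
Qed.

(** As [ML a] is continuous with value [1 > d] at [0], the preimages of points
    below [d] stay at a distance from [0]. *)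
Lemma phi_lower_bound a (c d : R) : 0 < a < 1 -> 0 < c -> d < 1 ->
  exists2 m, 0 < m & forall u, c <= u <= d -> m <= phi a u.
Proof.
move=> a01 c0 d1; have /andP[a0 _] := a01.
have := continuous_ML a a0 (0 : R); rewrite /continuous_at ML0// => /cvgr_gt /(_ d d1).
move=> /nbhs_ballP[e /= e0 he].
exists (c * e `^ a^-1); first by rewrite mulr_gt0// powR_gt0.
move=> u /andP[cu ud].
have u0 : 0 < u by exact: lt_le_trans cu.
have u1 : u < 1 by exact: le_lt_trans d1.
have L0 : ML_ln a u < 0 by apply: ML_ln_lt0; rewrite ?u0.
apply: ler_pM => //; [exact: ltW|exact: powR_ge0|].
apply: ge0_ler_powR; rewrite ?nnegrE ?invr_ge0 ?oppr_ge0 ?(ltW a0) ?(ltW L0) ?(ltW e0)//.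
rewrite leNgt; apply/negP => Le.
have := he (ML_ln a u); rewrite /ball/= sub0r normrN ltr0_norm// => /(_ Le).
by rewrite ML_lnK ?u0 ?ltW// ltNge ud.
Qed.

End phi.

(** * Comparison of integrals through simple functions *)

Section lower_integral.
Context d (T : measurableType d) (R : realType) (mu : {measure set T -> \bar R}).
Local Open Scope ereal_scope.
Import HBNNSimple.

(** Both integrals are suprema over the simple functions below the integrand,
    and scaling by [c] maps the simple functions below [f] to simple functions
    below [g]. The integrands in view are [phi a \o F], where [ML_ln a] is only
    known to be some right inverse of [ML a]; so the comparison is made at the
    level of simple functions, for arbitrary [f] and [g]. *)
Lemma le_integral_scale (D : set T) (f g : T -> R) (c : R) : (0 < c)%R ->
  (forall x, D x -> 0 <= f x)%R ->
  (forall x, D x -> c * f x <= g x)%R ->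
  c%:E * \int[mu]_(x in D) (f x)%:E <= \int[mu]_(x in D) (g x)%:E.
Proof.
move=> c0 f0 fg.
have g0 x : D x -> (0 <= g x)%R.
  by move=> Dx; apply: le_trans (fg x Dx); rewrite mulr_ge0 ?f0// ltW.
rewrite [X in _ * X]ge0_integralE; last by move=> x Dx; rewrite lee_fin f0.
rewrite [leRHS]ge0_integralE; last by move=> x Dx; rewrite lee_fin g0.
rewrite -lee_pdivlMl//; apply: ge_ereal_sup => _ [h /= hf <-].
rewrite lee_pdivlMl// -sintegralrM; apply: ereal_sup_ubound.
exists (scale_nnsfun h (ltW c0)) => //= x.
have := hf x; rewrite !patchE; case: ifPn => xD.
  rewrite !lee_fin => hx; apply: le_trans (fg x _); last by rewrite inE in xD.
  by rewrite ler_wpM2l// ltW.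
rewrite !lee_fin => hx; rewrite /= mulr_ge0_le0//; exact: ltW.
Qed.

End lower_integral.

(** * The EFCPE and the ratios of [phi] *)

Section efcpe.
Context {d : measure_display} {W : measurableType d} {R : realType}.
Context (P : probability W R).
Implicit Types (X : {RV P >-> R}) (a x : R).

Lemma cdfr_itv X x : 0 <= cdfr X x <= 1.
Proof.
rewrite /cdfr; have := cdf_ge0 X x; have := cdf_le1 X x.
by case: (cdf X x) => [r| |]//=; rewrite !lee_fin => -> ->.
Qed.

Lemma cdfr_nondecreasing X : {homo cdfr X : x y / x <= y}.
Proof.
move=> x y xy; apply: fine_le; rewrite ?fin_num_measure//.
exact: cdf_nondecreasing.
Qed.

Lemma cdfr_right_continuous X x : cdfr X y @[y --> x^'+] --> cdfr X x.
Proof.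
apply: fine_cvg; rewrite /cdfr fineK ?fin_num_measure//.
exact: cdf_right_continuous.
Qed.

Lemma EFCPE_ge0 X a : (0 <= EFCPE a X)%E.
Proof.
apply: integral_ge0 => x _; rewrite lee_fin phi_ge0//.
by case/andP: (cdfr_itv X x).
Qed.

(** By right continuity the cdf stays, on some interval to the right of [x], in
    a compact part of the open unit interval, where [phi a] is bounded away
    from [0]. *)
Lemma EFCPE_gt0 X a x : 0 < a < 1 -> 0 <= x -> 0 < cdfr X x < 1 ->
  (0 < EFCPE a X)%E.
Proof.
move=> a01 x0 /andP[F0 F1]; pose c := (cdfr X x + 1) / 2.
have [c1 Fc] : c < 1 /\ cdfr X x < c by rewrite /c; split; lra.
have [y [xy Fy]] : exists y, x < y /\ cdfr X y <= c.
  have Fle : \forall t \near x^'+, cdfr X t <= c.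
    exact: cvgr_le (cdfr_right_continuous X x) _ Fc.
  have Fgt := nbhs_right_gt x.
  by have [y [? ?]] := filter_ex (filterI Fgt Fle); exists y.
have [m m0 mphi] := phi_lower_bound a _ _ a01 F0 c1.
have sub : `[x, y] `<=` (`[0, +oo[ : set R).
  by move=> z /=; rewrite !in_itv/= andbT => /andP[xz _]; exact: le_trans xz.
have mA : measurable (`[x, y]%classic : set R) by [].
have : (m%:E * \int[lebesgue_measure]_(z in `[0%R, +oo[) (\1_(`[x, y]%classic) z)%:E
    <= EFCPE a X)%E.
  apply: le_integral_scale => // z _.
  rewrite indicE; have [|_] /= := boolP (z \in _); last first.
    by rewrite mulr0 phi_ge0//; case/andP: (cdfr_itv X z).
  rewrite inE/= in_itv/= => /andP[xz zy]; rewrite mulr1; apply: mphi.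
  rewrite cdfr_nondecreasing//= (le_trans _ Fy)//.
  exact: cdfr_nondecreasing.
apply: lt_le_trans; rewrite integral_indic// setIidl//.
rewrite /= lebesgue_measure_itv/= lte_fin xy -EFinB -EFinM lte_fin.
by rewrite mulr_gt0// subr_gt0.
Qed.

End efcpe.

Section omega.
Context {R : realType}.
Implicit Types (a u : R) (q : R -> R).

Lemma omega1_le a q u : 0 < u < 1 -> (omega1 a q <= (phi a (q u) / phi a u)%:E)%E.
Proof.
by move=> u01; apply: ereal_inf_lbound; exists u => //=; rewrite in_itv.
Qed.

Lemma omega2_ge a q u : 0 < u < 1 -> ((phi a (q u) / phi a u)%:E <= omega2 a q)%E.
Proof.
by move=> u01; apply: ereal_sup_ubound; exists u => //=; rewrite in_itv.
Qed.

End omega.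

Theorem proposition5p3 (R : realType) (n : nat)
    (d d' : measure_display) (W : measurableType d) (W' : measurableType d')
    (P : probability W R) (P' : probability W' R)
    (S : pred {set 'I_n})
    (X : {RV P' >-> R}) (Xs : 'I_n -> {RV P >-> R}) (T : {RV P >-> R})
    (q : R -> R) (alpha : R) :
  (0 < n)%N ->
  coherent S ->
  nonneg_ac X ->
  (forall i, nonneg_ac (Xs i)) ->
  nonneg_ac T ->
  (forall i x, cdf (Xs i) x = cdf X x) ->
  system_lifetime S (fun i w => Xs i w) (fun w => T w) ->
  distortion_function (cdfr X) (cdfr T) q ->
  0 < alpha < 1 ->
  (omega1 alpha q * EFCPE alpha X <= EFCPE alpha T
     <= omega2 alpha q * EFCPE alpha X)%E.
Proof.
move=> _ _ _ _ _ _ _ [q01 _ _ [q0 q1] FT] a01.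
have phiq_ge0 u : 0 <= u <= 1 -> 0 <= phi alpha (q u).
  move=> u01; have := q01 u; rewrite !in_itv/= => /(_ u01) /andP[? _].
  exact: phi_ge0.
(* at the values 0 and 1, which q fixes, both integrands vanish *)
have ends u : 0 <= u <= 1 -> ~~ (0 < u < 1) ->
    phi alpha u = 0 /\ phi alpha (q u) = 0.
  move=> /andP[u0 u1]; rewrite negb_and -!leNgt => /orP[u0'|u1'].
    have -> : u = 0 by apply/le_anti; rewrite u0 u0'.
    by rewrite q0 phi0.
  have -> : u = 1 by apply/le_anti; rewrite u1 u1'.
  by rewrite q1 phi1.
have half01 : 0 < (2^-1 : R) < 1 by apply/andP; split; lra.
have ratio_ge0 u : 0 < u < 1 -> 0 <= phi alpha (q u) / phi alpha u.
  move=> /[dup] u01 /andP[u0 u1].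
  by rewrite divr_ge0 ?phiq_ge0 ?phi_ge0// ?(ltW u0) ?(ltW u1).
apply/andP; split.
- have : (0 <= omega1 alpha q)%E.
    apply: le_ereal_inf_tmp => _ [u /= /[!in_itv]/= u01 <-].
    by rewrite lee_fin ratio_ge0.
  have := omega1_le alpha q; case: (omega1 alpha q) => [w| |] wle w0 //; last first.
    by have := wle _ half01.
  rewrite lee_fin le_eqVlt in w0; case/predU1P: w0 => [<-|w0].
    by rewrite mul0e EFCPE_ge0.
  apply: le_integral_scale => // x _.
    by rewrite phi_ge0//; case/andP: (cdfr_itv _ X x).
  rewrite FT; have F01 := cdfr_itv _ X x.
  have [u01|/(ends _ F01) [-> ->]] := boolP (0 < cdfr X x < 1); last by rewrite mulr0.
  by have := wle _ u01; rewrite lee_fin ler_pdivlMr// phi_gt0.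
- have := omega2_ge alpha q; case: (omega2 alpha q) => [w| |] wge; last first.
  + by have := wge _ half01.
  (* An infinite supremum gives no pointwise bound: either the integral for X
     is positive and the bound is infinite, or both integrands vanish. *)
  + have [[x [x0 x01]]|none] := pselect (exists x, 0 <= x /\ 0 < cdfr X x < 1).
      by rewrite gt0_mulye ?leey//; exact: (EFCPE_gt0 _ _ _ _ a01 x0 x01).
    suff -> : EFCPE alpha T = 0%E by rewrite mule_ge0 ?EFCPE_ge0.
    apply: integral0_eq => x /=; rewrite in_itv/= andbT => x0; congr (_%:E); rewrite FT.
    apply: (ends _ (cdfr_itv _ X x) _).2.
    by apply/negP => x01; apply: none; exists x.
  + have : 0 <= w by have := wge _ half01; rewrite lee_fin; exact/le_trans/ratio_ge0.
    rewrite le_eqVlt => /predU1P[w0|w0].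
      rewrite -w0 mul0e.
      suff -> : EFCPE alpha T = 0%E by [].
      apply: integral0_eq => x _; congr (_%:E); rewrite FT.
      have F01 := cdfr_itv _ X x.
      have [u01|/(ends _ F01) [_ ->]//] := boolP (0 < cdfr X x < 1).
      apply/le_anti; rewrite phiq_ge0// andbT.
      by have := wge _ u01; rewrite -w0 lee_fin ler_pdivrMr ?mul0r// phi_gt0.
    rewrite -lee_pdivrMl//; apply: le_integral_scale => [|x _|x _].
    * by rewrite invr_gt0.
    * by rewrite phi_ge0//; case/andP: (cdfr_itv _ T x).
    rewrite FT; have F01 := cdfr_itv _ X x.
    have [u01|/(ends _ F01) [-> ->]] := boolP (0 < cdfr X x < 1); last by rewrite mulr0.
    by have := wge _ u01; rewrite lee_fin ler_pdivrMr ?phi_gt0// ler_pdivrMl.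
Qed.
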